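(* Let $n\ge 1$ and let $A=\operatorname{diag}(a_{11},\ldots,a_{nn})$ and $A'=\operatorname{diag}(a'_{11},\ldots,a'_{nn})$ be diagonal matrices with $a_{ii},a'_{ii}\in\mathcal D$ for $i=1,\ldots,n$. If $A$ and $A'$ are similar over $\mathcal D$, then $\{a_{11},\ldots,a_{nn}\}=\{a'_{11},\ldots,a'_{nn}\}$ as multisets; that is, the diagonal entries of $A'$ are a permutation of the diagonal entries of $A$.
   Context: $K$ is an algebraically closed field of characteristic zero and $\mathcal D=K[\zeta]$ with $\zeta^2=0$ is the algebra of dual numbers over $K$. Matrices $A,B\in M_n(\mathcal D)$ are similar if there is an invertible $C\in M_n(\mathcal D)$ with $B=CAC^{-1}$. *)

(* Defs.v *)
From mathcomp Require Import all_boot all_order all_fingroup all_algebra.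

Set Implicit Arguments.
Unset Strict Implicit.
Unset Printing Implicit Defensive.

Import GRing.Theory.
Local Open Scope ring_scope.

(* K[zeta] with zeta ^ 2 = 0, realised as K[X] / (X ^ 2), zeta being 'qX.  As
   'X^2 is monic of size 3, mk_monic 'X^2 = 'X^2 (see mk_monic_Xn), so the
   quotient really is by 'X^2.  A notation rather than a definition, so that the
   ring structures of {poly %/ _} are inferred. *)
Notation dual_numbers K := {poly %/ ('X^2 : {poly K})}.

(* invmx C is the genuine inverse of C since C is required to be in unitmx. *)
Definition similar_mx (R : comUnitRingType) (n : nat) (A B : 'M[R]_n) : Prop :=
  exists2 C : 'M[R]_n, C \in unitmx & B = C *m A *m invmx C.

(* Main.v *)
Require Import Defs.
From mathcomp Require Import all_boot all_order all_fingroup all_algebra.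

Set Implicit Arguments.
Unset Strict Implicit.
Unset Printing Implicit Defensive.

Import GRing.Theory.
Local Open Scope ring_scope.

(** If [A' = C A C^-1], comparing entries in [A' C = C A] gives
    [(a'_ii - a_jj) c_ij = 0].  The dual numbers form a local ring, so the unit
    [\det C], being a signed sum of products [\prod_i c_(i, s i)], has a term all
    of whose factors are units; cancelling them gives [a'_ii = a_(s i)(s i)]. *)

Section LocalRing.

Variable R : comUnitRingType.
Hypothesis unit_add : forall x y : R,
  x + y \is a GRing.unit -> (x \is a GRing.unit) || (y \is a GRing.unit).

Lemma local_unit_sum (I : Type) (r : seq I) (F : I -> R) :
  \sum_(i <- r) F i \is a GRing.unit -> exists i, F i \is a GRing.unit.
Proof.
elim: r => [|i r IHr]; first by rewrite big_nil unitr0.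
by rewrite big_cons => /unit_add/orP[Fi|/IHr //]; exists i.
Qed.

Lemma local_unitmx_perm (n : nat) (C : 'M[R]_n) :
  C \in unitmx -> exists s : 'S_n, forall i, C i (s i) \is a GRing.unit.
Proof.
rewrite unitmxE => /local_unit_sum[s]; rewrite unitrM => /andP[_ /unitr_prodP Us].
by exists s => i; apply: Us => //; apply: mem_index_enum.
Qed.

Lemma local_similar_diag (n : nat) (a b : 'rV[R]_n) :
  similar_mx (diag_mx a) (diag_mx b) ->
  exists s : 'S_n, forall i, b 0 i = a 0 (s i).
Proof.
case=> C UC eqb; have [s Us] := local_unitmx_perm UC; exists s => i.
have /matrixP/(_ i (s i)) : diag_mx b *m C = C *m diag_mx a.
  by rewrite eqb mulmxKV.
by rewrite mul_diag_mx mul_mx_diag !mxE mulrC => /(mulrI (Us i)).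
Qed.

End LocalRing.

(** Units of the quotient are by definition the classes coprime to the modulus, and coprimality to
    ['X^2] amounts to coprimality to ['X]. *)
Lemma dual_numbers_unitE (K : fieldType) (x : dual_numbers K) :
  (x \is a GRing.unit) = ((x : {poly K}).[0] != 0).
Proof.
rewrite -[LHS]/(coprimep (mk_monic 'X^2) x); move: (polyn x) => p.
by rewrite mk_monic_Xn coprimep_pexpl // coprimep_sym coprimepX.
Qed.

Theorem theorem2p1 (K : closedFieldType) (hchar : [pchar K] =i pred0)
    (n : nat) (hn : (1 <= n)%N) (a a' : 'rV[dual_numbers K]_n) :
  similar_mx (diag_mx a) (diag_mx a') ->
  exists s : 'S_n, forall i : 'I_n, a' 0 i = a 0 (s i).
Proof.
(* What remains is locality: the constant term is additive, so nonunits are closed under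
   addition. *)
apply: local_similar_diag => x y.
rewrite !dual_numbers_unitE poly_of_qpolyD hornerD -negb_and.
by apply: contra => /andP[/eqP-> /eqP->]; rewrite addr0.
Qed.
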